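(* Let $T$ be a bounded linear operator on a complex Hilbert space $H$. If $T$ has closed range, is cyclic, and has infinite-dimensional kernel, then $T$ is universal for $H$.
   Context: An operator $T\in B(H)$ is cyclic if there is a vector $f\in H$ such that $\mathrm{span}\{f,Tf,T^2f,\ldots\}$ is dense in $H$. For a complex, separable, infinite-dimensional Hilbert space $H$, an operator $U\in B(H)$ is universal for $H$ if for every $T\in B(H)$ there exist a closed invariant subspace $M$ of $U$, a complex number $\alpha\neq 0$, and a (bounded linear, boundedly invertible) isomorphism $S:M\to H$ such that $\alpha T=S\,U|_M\,S^{-1}$. *)

(* Defs.v *)
From HB Require Import structures.
From mathcomp Require Import all_boot all_order all_algebra.
From mathcomp Require Import all_classical all_reals all_analysis.
From mathcomp Require Import complex.

Set Implicit Arguments.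
Unset Strict Implicit.
Unset Printing Implicit Defensive.

Import Order.TTheory GRing.Theory Num.Theory numFieldNormedType.Exports.
Local Open Scope classical_set_scope.
Local Open Scope ring_scope.

(* The scalar field is R[i]: norms are R[i]-valued (real and nonnegative), and
   {dot H for Num.conj} is a positive definite form, linear in its first and
   conjugate-linear in its second argument. *)
HB.mixin Record isHilbert (R : realType) H of CompleteNormedModule R[i] H := {
  inner : {dot H for @Num.conj R[i]} ;
  sqr_norm_inner : forall x : H, `|x| ^+ 2 = inner x x
}.

#[short(type="hilbertType")]
HB.structure Definition Hilbert (R : realType) :=
  {H of CompleteNormedModule R[i] H & isHilbert R H}.

Definition lin_span (K : nzRingType) (V : lmodType K) (A : set V) : set V :=
  [set x | exists n (c : 'I_n -> K) (v : 'I_n -> V),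
     (forall i, A (v i)) /\ x = \sum_(i < n) c i *: v i].

Definition finite_dim (K : nzRingType) (V : lmodType K) (M : set V) : Prop :=
  exists s : seq V, M = lin_span [set` s].

Definition separable_space (T : topologicalType) : Prop :=
  exists2 D : set T, countable D & dense D.

Definition bounded_on (K : numFieldType) (V W : normedModType K)
    (A : set V) (f : V -> W) : Prop :=
  exists C : K, forall x, A x -> `|f x| <= C * `|x|.

Definition bounded_op (K : numFieldType) (V W : normedModType K)
    (f : V -> W) : Prop :=
  bounded_on setT f.

Definition cyclic_op (K : numFieldType) (V : normedModType K)
    (T : V -> V) : Prop :=
  exists f : V, dense (lin_span (range (fun n : nat => iter n T f))).

Definition ker (U V : zmodType) (f : U -> V) : set U := f @^-1` [set 0].

Definition closed_invariant_subspace (K : numFieldType) (V : normedModType K)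
    (U : V -> V) (M : set V) : Prop :=
  [/\ submod_closed [in M], closed M & forall x, M x -> M (U x)].

(* A bounded isomorphism S : M -> W with bounded inverse Si : W -> M.  Only the
   values of S on the subspace M are constrained; off M it is arbitrary. *)
Record subspace_iso (K : numFieldType) (V W : normedModType K)
    (M : set V) (S : V -> W) (Si : W -> V) : Prop := SubspaceIso {
  iso_linear : forall (a : K) (x y : V), M x -> M y ->
    S (a *: x + y) = a *: S x + S y ;
  iso_bounded : bounded_on M S ;
  iso_inv_mem : forall y, M (Si y) ;
  iso_inv_bounded : bounded_op Si ;
  isoK : forall x, M x -> Si (S x) = x ;
  iso_invK : forall y, S (Si y) = y
}.

(* Universality is only defined on separable, infinite-dimensional spaces, so
   these requirements on H are part of the predicate. *)
Definition universal (R : realType) (H : hilbertType R)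
    (U : {linear H -> H}) : Prop :=
  [/\ separable_space H,
      ~ finite_dim [set: H] &
      forall T : {linear H -> H}, bounded_op T ->
        exists (M : set H) (alpha : R[i]) (S Si : H -> H),
          [/\ closed_invariant_subspace U M, alpha != 0, subspace_iso M S Si &
              forall x : H, alpha *: T x = S (U (Si x))]].

(* Main.v *)
Require Import Defs.
From HB Require Import structures.
From mathcomp Require Import all_boot all_order all_algebra.
From mathcomp Require Import all_classical all_reals all_analysis.
From mathcomp Require Import complex.
From mathcomp Require Import ring lra.
Set Implicit Arguments.
Unset Strict Implicit.
Unset Printing Implicit Defensive.
Import Order.TTheory GRing.Theory Num.Theory numFieldNormedType.Exports.
Local Open Scope classical_set_scope.
Local Open Scope ring_scope.

(** The classical case is that of a surjective T with infinite-dimensional kernel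
    (Caradus). Choose a bounded right inverse V of T and an isometric embedding W
    of H into the kernel of T. For a given operator A and a small scalar a, the
    series X of the a^n V^n W A^n converges and satisfies X = W + a V X A. Applying
    T gives T X = a X A, so that range X is invariant under T; moreover
    W = X - V T X, so X is bounded below, hence an isomorphism of H onto its closed
    range, and it conjugates the restriction of T to that range to a A
    ([caradus], [closed_range_bounded_below]).

    Here T need not be surjective, but cyclicity together with the closed range
    makes the range of T of codimension at most one ([cyclic_corange]). This is
    enough to find a closed invariant subspace M with T M = M on which the kernel
    of T is still infinite-dimensional ([surjective_part]), and the argument above
    only needs V and W to take values in M. If the kernel of T is contained in
    range T^n for all n, then M is the intersection of these ranges. Otherwise M is
    the first range T^N that does not contain the kernel: its codimension in range
    T^(N-1) is at most one, and a vector of the kernel outside M fills the gap, so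
    T M = T (range T^(N-1)) = M.

    The rest is Hilbert space theory. The right inverse comes from the open mapping
    theorem, by taking preimages orthogonal to the kernel
    ([bounded_right_inverse]). The embedding W maps an orthonormal system that is
    complete in H, obtained from the orbit of the cyclic vector by Gram-Schmidt, to
    an orthonormal sequence of the kernel ([isometry_exists]). The orbit of the
    cyclic vector also yields separability: its combinations with rational complex
    coefficients are dense ([dense_span_separable]). *)

(** * Norms as real numbers, and convergence *)

Section RealNorm.
Variable R : realType.
Local Notation C := R[i].

(** The norms at hand take values in R[i], which is only partially ordered; the
    real number carrying the same information is totally ordered, and estimates
    on it are within reach of real arithmetic. *)
Definition rnorm (V : normedZmodType C) (x : V) : R := complex.Re `|x|.

Lemma rnormE (V : normedZmodType C) (x : V) : `|x| = (rnorm x)%:C%C.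
Proof. by rewrite /rnorm RRe_real // normr_real. Qed.

Lemma rnorm_ge0 (V : normedZmodType C) (x : V) : 0 <= rnorm x.
Proof. by rewrite -ler0c -rnormE. Qed.

Lemma rnorm0 (V : normedZmodType C) : rnorm (0 : V) = 0.
Proof. by rewrite /rnorm normr0. Qed.

Lemma rnorm_eq0 (V : normedZmodType C) (x : V) : rnorm x = 0 -> x = 0.
Proof. by move=> x0; apply/eqP; rewrite -normr_eq0 rnormE x0. Qed.

Lemma rnorm_gt0 (V : normedZmodType C) (x : V) : x != 0 -> 0 < rnorm x.
Proof.
move=> x0; rewrite lt_neqAle rnorm_ge0 andbT eq_sym.
by apply: contraNneq x0 => /rnorm_eq0 ->.
Qed.

Lemma rnormN (V : normedZmodType C) (x : V) : rnorm (- x) = rnorm x.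
Proof. by rewrite /rnorm normrN. Qed.

Lemma rnormD (V : normedZmodType C) (x y : V) :
  rnorm (x + y) <= rnorm x + rnorm y.
Proof. by rewrite -lecR rmorphD /= -!rnormE ler_normD. Qed.

Lemma rnormB (V : normedZmodType C) (x y : V) :
  rnorm (x - y) <= rnorm x + rnorm y.
Proof. by rewrite -(rnormN y) rnormD. Qed.

Lemma rnorm_distC (V : normedZmodType C) (x y : V) :
  rnorm (x - y) = rnorm (y - x).
Proof. by rewrite -rnormN opprB. Qed.

Lemma rnorm_distD (V : normedZmodType C) (z x y : V) :
  rnorm (x - y) <= rnorm (x - z) + rnorm (z - y).
Proof. by rewrite -[x - y](subrKA z) rnormD. Qed.

Lemma rnormZ (V : normedModType C) (a : C) (x : V) :
  rnorm (a *: x) = rnorm a * rnorm x.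
Proof. by apply/complexI; rewrite rmorphM /= -!rnormE normrZ. Qed.

Lemma rnormM (a b : C) : rnorm (a * b) = rnorm a * rnorm b.
Proof. exact: (@rnormZ C^o). Qed.

Lemma rnorm_real (r : R) : rnorm (r%:C%C : C) = `|r|.
Proof. by rewrite /rnorm normc_def /= expr0n addr0 sqrtr_sqr. Qed.

Lemma rnormV (a : C) : rnorm a^-1 = (rnorm a)^-1.
Proof. by apply/complexI; rewrite fmorphV /= -!rnormE normfV. Qed.

Lemma bounded_onP (V W : normedModType C) (A : set V) (f : V -> W) :
  bounded_on A f <->
  exists2 c : R, 0 <= c & forall x, A x -> rnorm (f x) <= c * rnorm x.
Proof.
split=> [[c fc]|[c c0 fc]].
- exists (Num.max (complex.Re c) 0); first by rewrite le_max lexx orbT.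
  move=> x /fc; rewrite !rnormE lecE => /andP[_].
  case: (c) => u v /=; rewrite mulr0 subr0 => /le_trans; apply.
  by rewrite ler_wpM2r ?rnorm_ge0// le_max lexx.
- by exists c%:C%C => x /fc; rewrite !rnormE -rmorphM lecR.
Qed.

Lemma bounded_opP (V W : normedModType C) (f : V -> W) :
  bounded_op f <->
  exists2 c : R, 0 <= c & forall x, rnorm (f x) <= c * rnorm x.
Proof.
rewrite /bounded_op bounded_onP; split=> -[c c0 fc]; exists c => // x; exact: fc.
Qed.

Lemma complex_gt0P (e : C) : 0 < e -> exists2 r : R, 0 < r & e = r%:C%C.
Proof.
move=> e0; have eE : (complex.Re e)%:C%C = e by rewrite RRe_real// gtr0_real.
by exists (complex.Re e) => //; rewrite -(@ltcR R) eE.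
Qed.

Lemma cvg_rnormP (V : normedModType C) (s : nat -> V) (l : V) :
  s @ \oo --> l <->
  forall e : R, 0 < e -> exists N, forall n, (N <= n)%N -> rnorm (l - s n) < e.
Proof.
split=> [/cvgrPdist_lt sl e e0|sl].
- have /sl [N _ Nsl] : 0 < e%:C%C :> C by rewrite ltcR.
  by exists N => n /Nsl /=; rewrite rnormE ltcR.
- apply/cvgrPdist_lt => e /complex_gt0P[r r0 ->].
  have [N Nsl] := sl _ r0.
  by exists N => // n /Nsl /=; rewrite rnormE ltcR.
Qed.

Lemma cvg_rnorm (V : normedModType C) (s : nat -> V) (l : V) :
  s @ \oo --> l -> (fun n => rnorm (s n)) @ \oo --> rnorm l.
Proof.
move=> /cvg_rnormP sl; apply/cvgrPdist_lt => e /sl[N Nsl].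
exists N => // n /Nsl; apply: le_lt_trans.
have := rnorm_distD 0 l (s n); have := rnormD (l - s n) (s n).
have := rnormD (s n - l) l; rewrite !subrK (rnorm_distC (s n)) => h1 h2 _.
by rewrite ler_norml /=; apply/andP; split; lra.
Qed.

Lemma rnorm_lim_le (V : normedModType C) (s : nat -> V) (l : V) (c : R) :
  s @ \oo --> l -> (forall n, rnorm (s n) <= c) -> rnorm l <= c.
Proof.
move=> /cvg_rnorm sl sc; apply: (closed_cvg (fun x => x <= c)) sl.
  exact: closed_le.
exact: nearW.
Qed.

Lemma cauchy_rnorm_cvg (V : completeNormedModType C) (s : nat -> V) :
  (forall e : R, 0 < e -> exists N, forall m n, (N <= m)%N -> (N <= n)%N ->
     rnorm (s m - s n) < e) ->
  exists l : V, s @ \oo --> l.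
Proof.
move=> sC; apply/cvg_ex/cauchy_cvgP/cauchy_ballP => e /complex_gt0P[r r0 ->].
have [N Ns] := sC _ r0.
exists ([set s n | n in [set n | (N <= n)%N]], [set s n | n in [set n | (N <= n)%N]]).
  by split; exists N => // n Nn; exists n.
move=> [_ _] [[m Nm <-]] [n Nn <-].
by rewrite -ball_normE /= rnormE ltcR; exact: Ns.
Qed.

Lemma bounded_cvg (V W : normedModType C) (f : V -> W) (s : nat -> V) (l : V) :
  linear f -> bounded_op f -> s @ \oo --> l -> (f \o s) @ \oo --> f l.
Proof.
move=> fL /bounded_opP[c c0 fc] /cvg_rnormP sl; apply/cvg_rnormP => e e0.
have /sl [N Ns] : 0 < e / (c + 1) by rewrite divr_gt0// ltr_wpDl.
exists N => n /Ns {}Ns; rewrite -(zmod_morphism_linear fL).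
apply: (le_lt_trans (fc _)).
rewrite ltr_pdivlMr ?ltr_wpDl// in Ns.
by have := rnorm_ge0 (l - s n); nra.
Qed.

Lemma geometric_small (c e : R) : 0 < e -> exists N, c / 2 ^+ N < e.
Proof.
move=> e0; exists (Num.truncn (c / e)).+1.
rewrite ltr_pdivrMr ?exprn_gt0// [e * _]mulrC -ltr_pdivrMr//.
apply: (lt_le_trans (truncnS_gt _)).
by rewrite -natrX ler_nat; exact/ltnW/ltn_expl.
Qed.

(** Increments dominated by a geometric sequence make a sequence converge; the
    explicit bound on the limit is what turns a series of approximations into a
    bounded operator. *)
Lemma geometric_cvg (V : completeNormedModType C) (s : nat -> V) (c : R) :
  (forall n, rnorm (s n.+1 - s n) <= c / 2 ^+ n) ->
  exists2 l : V, s @ \oo --> l & forall n, rnorm (l - s n) <= 2 * c / 2 ^+ n.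
Proof.
move=> sc.
have pow_gt0 n : 0 < 2 ^+ n :> R by rewrite exprn_gt0.
have c0 : 0 <= c.
  by have := sc 0%N; rewrite expr0 divr1; exact/le_trans/rnorm_ge0.
have sD n k : rnorm (s (n + k)%N - s n) <= 2 * c / 2 ^+ n - 2 * c / 2 ^+ (n + k).
  elim: k => [|k IH]; first by rewrite addn0 !subrr rnorm0.
  apply: (le_trans (rnorm_distD (s (n + k)%N) _ _)).
  have -> : 2 * c / 2 ^+ n - 2 * c / 2 ^+ (n + k.+1) =
     c / 2 ^+ (n + k) + (2 * c / 2 ^+ n - 2 * c / 2 ^+ (n + k)).
    rewrite addnS exprS; field.
    by rewrite !gt_eqF.
  by apply: lerD => //; rewrite addnS; exact: sc.
have sB n k : rnorm (s (n + k)%N - s n) <= 2 * c / 2 ^+ n.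
  apply: (le_trans (sD n k)).
  by rewrite lerBlDr lerDl divr_ge0 ?mulr_ge0// ltW.
have [l sl] : exists l : V, s @ \oo --> l.
  apply: cauchy_rnorm_cvg => e e0.
  have [N Ne] := geometric_small (4 * c) e0.
  exists N => m n Nm Nn; apply: le_lt_trans Ne.
  apply: (le_trans (rnorm_distD (s N) _ _)); rewrite (rnorm_distC (s N)).
  have := sB N (m - N)%N; have := sB N (n - N)%N; rewrite !subnKC// => h1 h2.
  rewrite (_ : 4 * c / 2 ^+ N = 2 * c / 2 ^+ N + 2 * c / 2 ^+ N); last first.
    by rewrite -mulrDl -mulrDl -natrD.
  exact: lerD.
exists l => // n; apply: (@rnorm_lim_le _ (fun k => s (k + n)%N - s n)).
  by apply: cvgB; [rewrite -(cvg_shiftn n) in sl | exact: cvg_cst].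
by move=> k; rewrite addnC.
Qed.

End RealNorm.

(** * Subspaces and linear spans *)

Section Subspaces.
Variables (K : fieldType) (V : lmodType K).
Implicit Types (M N : set V) (s : seq V).

Definition subspace M := M 0 /\ forall a x y, M x -> M y -> M (a *: x + y).

Lemma subspaceP M : submod_closed [in M] <-> subspace M.
Proof.
split=> -[M0 ML]; split.
- by move: M0; rewrite inE.
- by move=> a x y /mem_set Mx /mem_set My; apply/set_mem/ML.
- by rewrite inE.
- by move=> a x y; rewrite !inE; exact: ML.
Qed.

Lemma subspaceZ M a x : subspace M -> M x -> M (a *: x).
Proof. by move=> [M0 ML] Mx; rewrite -[_ *: _]addr0; exact: ML. Qed.

Lemma subspaceD M x y : subspace M -> M x -> M y -> M (x + y).
Proof. by move=> [M0 ML] Mx My; rewrite -[x]scale1r; exact: ML. Qed.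

Lemma subspaceB M x y : subspace M -> M x -> M y -> M (x - y).
Proof. by move=> [M0 ML] Mx My; rewrite addrC -scaleN1r; exact: ML. Qed.

Lemma subspace_sum M (I : Type) (r : seq I) (P : pred I) (F : I -> V) :
  subspace M -> (forall i, P i -> M (F i)) -> M (\sum_(i <- r | P i) F i).
Proof.
move=> Msub MF; elim/big_ind : _ => //; first by case: Msub.
by move=> x y; exact: subspaceD.
Qed.

Lemma subspaceI M N : subspace M -> subspace N -> subspace (M `&` N).
Proof.
move=> [M0 ML] [N0 NL]; split=> // a x y [Mx Nx] [My Ny].
by split; [exact: ML | exact: NL].
Qed.

Lemma linear_at0 (W : lmodType K) (f : V -> W) : linear f -> f 0 = 0.
Proof. by move=> fL; have := zmod_morphism_linear fL 0 0; rewrite !subrr. Qed.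

Lemma subspace_range (W : lmodType K) (f : W -> V) :
  linear f -> subspace (range f).
Proof.
move=> fL; split.
  by exists 0 => //; have := zmod_morphism_linear fL 0 0; rewrite !subrr.
by move=> a _ _ [x _ <-] [y _ <-]; exists (a *: x + y); rewrite ?fL.
Qed.

Lemma subspace_ker (W : lmodType K) (f : V -> W) :
  linear f -> subspace (ker f).
Proof.
move=> fL; rewrite /ker /preimage; split=> /=.
  exact: linear_at0.
by move=> a x y fx fy; rewrite fL fx fy scaler0 addr0.
Qed.

Lemma lin_span_subspace (A : set V) : subspace (lin_span A).
Proof.
split; first by exists 0%N, (fun=> 0), (fun=> 0); split=> [[]//|]; rewrite big_ord0.
move=> a _ _ [m [c [v [Av ->]]]] [n [d [w [Aw ->]]]].
exists (m + n)%N.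
exists (fun i => match fintype.split i with inl j => a * c j | inr j => d j end).
exists (fun i => match fintype.split i with inl j => v j | inr j => w j end).
split; first by move=> i; case: (fintype.split i).
rewrite big_split_ord /= scaler_sumr; congr (_ + _); apply: eq_bigr => i _.
- by rewrite (unsplitK (inl _)) scalerA.
- by rewrite (unsplitK (inr _)).
Qed.

Lemma sub_lin_span (A : set V) : A `<=` lin_span A.
Proof.
move=> x Ax; exists 1%N, (fun=> 1), (fun=> x); split=> //.
by rewrite big_ord1 scale1r.
Qed.

Lemma lin_span_min (A : set V) M :
  subspace M -> A `<=` M -> lin_span A `<=` M.
Proof.
move=> Msub AM _ [n [c [v [Av ->]]]]; apply: subspace_sum => // i _.
by apply: subspaceZ => //; exact: AM.
Qed.

Lemma subspace_add_line M w :
  subspace M -> subspace [set x | exists a, M (x - a *: w)].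
Proof.
move=> [M0 ML]; split=> /=; first by exists 0; rewrite scale0r subrr.
move=> a y z [b My] [c Mz]; exists (a * b + c).
have -> : a *: y + z - (a * b + c) *: w = a *: (y - b *: w) + (z - c *: w).
  by rewrite scalerBr scalerDl scalerA opprD addrACA.
exact: ML.
Qed.

(** Steinitz exchange modulo M: on a line of cosets, any vector outside M can
    replace the given direction. *)
Lemma line_exchange M v w x a b :
  subspace M -> M (w - a *: v) -> M (x - b *: v) -> ~ M w ->
  exists c, M (x - c *: w).
Proof.
move=> Msub Mwv Mxv nMw.
have a0 : a != 0.
  by apply: contra_notN nMw => /eqP a0; move: Mwv; rewrite a0 scale0r subr0.
exists (b / a).
have -> : x - (b / a) *: w = (x - b *: v) - (b / a) *: (w - a *: v).
  rewrite scalerBr scalerA divfK// opprB addrACA addrA; congr (_ + _).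
  by rewrite addrK.
by apply: subspaceB => //; exact: subspaceZ.
Qed.

Lemma lin_span_cons v s x :
  lin_span [set` v :: s] x <-> exists a, lin_span [set` s] (x - a *: v).
Proof.
split=> [|[a]].
- apply: (@lin_span_min _ [set x | exists a, lin_span [set` s] (x - a *: v)]).
  + exact/subspace_add_line/lin_span_subspace.
  + move=> y /=; rewrite inE => /orP[/eqP ->|sy].
      by exists 1; rewrite scale1r subrr; exact: (lin_span_subspace _).1.
    by exists 0; rewrite scale0r subr0; exact: sub_lin_span.
- move=> sx; rewrite -(subrK (a *: v) x); apply: subspaceD.
  + exact: lin_span_subspace.
  + move: sx; apply: lin_span_min; first exact: lin_span_subspace.
    by move=> y /= sy; apply: sub_lin_span; rewrite /= inE sy orbT.
  + apply: subspaceZ; first exact: lin_span_subspace.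
    by apply: sub_lin_span; rewrite /= mem_head.
Qed.

(** A line complementing a finite-dimensional part: the vectors that span the
    part, together with w, span the whole. *)
Lemma finite_dim_add_line M N w :
  subspace M -> M w -> (forall x, M x -> exists a, N (x - a *: w)) ->
  finite_dim (M `&` N) -> finite_dim M.
Proof.
move=> Msub Mw MNw [s sE]; exists (w :: s); apply/seteqP; split=> x.
- move=> Mx; have [a Na] := MNw x Mx.
  apply/lin_span_cons; exists a; rewrite -sE; split=> //.
  by apply: subspaceB => //; exact: subspaceZ.
- move=> /lin_span_cons[a]; rewrite -sE => -[Ma _].
  by rewrite -(subrK (a *: w) x); apply: subspaceD => //; exact: subspaceZ.
Qed.

Lemma finite_dim_sub M N :
  subspace M -> finite_dim N -> M `<=` N -> finite_dim M.
Proof.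
move=> Msub [s ->] {N}; elim: s M Msub => [|v s IH] M Msub Ms.
  by exists [::]; apply/seteqP; split=> // x /lin_span_min; apply=> // y.
have IHs : finite_dim (M `&` lin_span [set` s]).
  apply: IH; last by move=> x [].
  by apply: subspaceI => //; exact: lin_span_subspace.
have [Msub_s|] := pselect (M `<=` lin_span [set` s]).
  by move: IHs; rewrite setIidl.
move=> /existsNP[w /not_implyP[Mw nsw]].
apply: (@finite_dim_add_line _ (lin_span [set` s]) w) => // x Mx.
have /lin_span_cons[a sa] := Ms _ Mw; have /lin_span_cons[b sb] := Ms _ Mx.
by apply: line_exchange sa sb nsw; exact: lin_span_subspace.
Qed.

End Subspaces.

(** * Inner product and orthogonal projection *)

Section InnerProduct.
Variables (R : realType) (H : hilbertType R).
Local Notation C := R[i].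
Implicit Types (x y z : H) (A : set H).

Lemma innerC x y : inner y x = ((inner x y)^*)%R.
Proof. by rewrite hermC /= expr0 mul1r. Qed.

Lemma innerZl a x y : inner (a *: x) y = a * inner x y.
Proof. by rewrite linearZl_LR. Qed.

Lemma innerZr a x y : inner x (a *: y) = (a^*)%R * inner x y.
Proof. by rewrite linearZr_LR. Qed.

Lemma innerDl x y z : inner (x + y) z = inner x z + inner y z.
Proof. by rewrite linearDl. Qed.

Lemma innerDr x y z : inner z (x + y) = inner z x + inner z y.
Proof. by rewrite linearDr. Qed.

Lemma innerNl x y : inner (- x) y = - inner x y.
Proof. by rewrite linearNl. Qed.

Lemma innerNr x y : inner y (- x) = - inner y x.
Proof. by rewrite linearNr. Qed.

Lemma inner_eq0C x y : inner x y = 0 -> inner y x = 0.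
Proof. by move=> xy0; rewrite innerC xy0 rmorph0. Qed.

Lemma innerxx x : inner x x = (rnorm x ^+ 2)%:C%C.
Proof. by rewrite -sqr_norm_inner rnormE rmorphXn. Qed.

Lemma Re_innerC x y : complex.Re (inner y x) = complex.Re (inner x y).
Proof. by rewrite innerC; case: (inner x y). Qed.

Lemma conj_mul_rnorm (a : C) : (a^*)%R * a = (rnorm a ^+ 2)%:C%C.
Proof. by rewrite mulrC -normCK rnormE rmorphXn. Qed.

Lemma rnormD_sqr x y :
  rnorm (x + y) ^+ 2 = rnorm x ^+ 2 + rnorm y ^+ 2 + 2 * complex.Re (inner x y).
Proof.
have := congr1 (@complex.Re R) (innerxx (x + y)).
rewrite innerDl !innerDr !innerxx !raddfD /= => <-.
by rewrite Re_innerC; ring.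
Qed.

Lemma rnormB_sqr x y :
  rnorm (x - y) ^+ 2 = rnorm x ^+ 2 + rnorm y ^+ 2 - 2 * complex.Re (inner x y).
Proof. by rewrite rnormD_sqr rnormN innerNr raddfN /=; ring. Qed.

Lemma pythagoras x y :
  inner x y = 0 -> rnorm (x + y) ^+ 2 = rnorm x ^+ 2 + rnorm y ^+ 2.
Proof. by move=> xy0; rewrite rnormD_sqr xy0 /= mulr0 addr0. Qed.

Lemma conj_real (s : R) : ((s%:C%C : C)^*)%R = s%:C%C.
Proof. exact: conjc_real. Qed.

(** Moving x towards y along the phase of their inner product: minimality and
    positivity are both exploited through this formula, for a suitable s. *)
Lemma rnormB_phase_sqr x y (s : R) :
  rnorm (x - (s%:C%C * inner x y) *: y) ^+ 2 =
  rnorm x ^+ 2 - 2 * s * rnorm (inner x y) ^+ 2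
    + s ^+ 2 * rnorm (inner x y) ^+ 2 * rnorm y ^+ 2.
Proof.
rewrite rnormB_sqr innerZr rmorphM /= conj_real -mulrA conj_mul_rnorm.
rewrite rnormZ rnormM rnorm_real -rmorphM /= !exprMn real_normK ?num_real//.
by ring.
Qed.

Lemma cauchy_schwarz x y : rnorm (inner x y) <= rnorm x * rnorm y.
Proof.
have [->|y0] := eqVneq y 0; first by rewrite linear0r !rnorm0 mulr0.
rewrite -(@ler_pXn2r _ 2)// ?nnegrE ?mulr_ge0 ?rnorm_ge0//.
have := sqr_ge0 (rnorm (x - (((rnorm y ^+ 2)^-1)%:C%C * inner x y) *: y)).
have yp : 0 < rnorm y ^+ 2 by rewrite exprn_gt0 ?rnorm_gt0.
rewrite rnormB_phase_sqr exprMn -ler_pdivrMr//.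
set p := rnorm (inner x y) ^+ 2; set q := rnorm y ^+ 2 in yp *.
have -> : q^-1 ^+ 2 * p * q = p / q by field; exact: lt0r_neq0.
have -> : 2 / q * p = 2 * (p / q) by field; exact: lt0r_neq0.
by move=> h; lra.
Qed.

Lemma closed_rnormP A :
  closed A <->
  forall x, (forall e : R, 0 < e -> exists2 a, A a & rnorm (x - a) < e) -> A x.
Proof.
split=> [Acl x xA|Acl x xA].
- apply: Acl => B /nbhs_ballP[e /complex_gt0P[r r0 ->]] rB.
  have [a Aa xa] := xA r r0; exists a; split=> //; apply: rB.
  by rewrite -ball_normE /= rnormE ltcR.
- apply: Acl => e e0.
  have [|a [Aa]] := xA (ball x (e%:C%C : C)).
    by apply: nbhsx_ballx; rewrite ltcR.
  by rewrite -ball_normE /= rnormE ltcR => xa; exists a.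
Qed.

Lemma closed_cvg_mem A (s : nat -> H) (l : H) :
  closed A -> (forall n, A (s n)) -> s @ \oo --> l -> A l.
Proof. by move=> Acl As; apply: closed_cvg => //; exact: nearW. Qed.

Lemma dense_sub_closed A (D : set H) : dense D -> closed A -> D `<=` A -> A = setT.
Proof.
move=> Dd Acl DA; apply: contrapT => AT.
have [x nAx] : exists x, ~ A x.
  by apply/existsNP => Ax; apply: AT; apply/seteqP; split.
have [|z [Az /DA]] := Dd (~` A) _ (closed_openC Acl); first by exists x.
exact: Az.
Qed.

Definition csubspace A := subspace A /\ closed A.

Lemma csubspaceI A B : csubspace A -> csubspace B -> csubspace (A `&` B).
Proof.
by move=> [As Ac] [Bs Bc]; split; [exact: subspaceI | exact: closedI].
Qed.

Definition is_proj A x p := A p /\ forall a, A a -> inner (x - p) a = 0.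

(** A minimizing sequence for the distance to x is Cauchy by the parallelogram
    law, since the midpoint of two almost minimizers cannot be closer to x than
    the infimum; orthogonality is the first-order condition at the minimum. *)
Lemma proj_exists A x : csubspace A -> exists p, is_proj A x p.
Proof.
move=> [As Acl].
pose D := [set rnorm (x - a) ^+ 2 | a in A].
have D0 : D !=set0 by exists (rnorm (x - 0) ^+ 2), 0 => //; case: As.
have Dlb : lbound D 0 by move=> _ [a _ <-]; exact: sqr_ge0.
have Dinf : has_inf D by split=> //; exists 0.
pose d := inf D.
have dle a : A a -> d <= rnorm (x - a) ^+ 2.
  by move=> Aa; apply: ge_inf; [exists 0 | exists a].
have /choice[s sP] : forall n : nat, exists a, A a /\ rnorm (x - a) ^+ 2 < d + n.+1%:R^-1.
  move=> n; have n0 : 0 < (n.+1%:R : R)^-1 by rewrite invr_gt0.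
  by have [_ [a Aa <-] ad] := inf_adherent n0 Dinf; exists a.
(* Parallelogram law applied to x - a and x - b. *)
have near_min a b e : A a -> A b -> rnorm (x - a) ^+ 2 < d + e ->
    rnorm (x - b) ^+ 2 < d + e -> rnorm (a - b) ^+ 2 < 4 * e.
  move=> Aa Ab xa xb.
  have /dle : A (2^-1 *: (a + b)) by apply: subspaceZ => //; exact: subspaceD.
  have xab : x - 2^-1 *: (a + b) = 2^-1 *: ((x - a) + (x - b)).
    have -> : (x - a) + (x - b) = (2 : C) *: x - (a + b).
      by rewrite addrACA -opprD scaler_nat mulr2n.
    by rewrite scalerBr scalerA mulVf ?scale1r// pnatr_eq0.
  rewrite xab rnormZ rnormV.
  have -> : rnorm (2 : C) = 2.
    by rewrite -[2](rmorph_nat (real_complex R)) rnorm_real ger0_norm.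
  rewrite exprMn.
  have := rnormD_sqr (x - a) (x - b); have := rnormB_sqr (x - a) (x - b).
  have -> : x - a - (x - b) = b - a by rewrite opprB addrC subrKA.
  rewrite (rnorm_distC b); lra.
have [p sp] : exists p : H, s @ \oo --> p.
  apply: cauchy_rnorm_cvg => e e0.
  have [N Ne] : exists N : nat, N.+1%:R^-1 < e ^+ 2 / 4.
    exists (Num.truncn (4 / e ^+ 2)).
    rewrite -[e ^+ 2 / 4]invrK ltf_pV2 ?posrE ?invr_gt0 ?divr_gt0 ?exprn_gt0//.
    by rewrite invf_div; exact: truncnS_gt.
  have sN m : (N <= m)%N -> rnorm (x - s m) ^+ 2 < d + N.+1%:R^-1.
    move=> Nm; apply: (lt_le_trans (sP m).2); rewrite lerD2l.
    by rewrite lef_pV2 ?posrE// ler_nat.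
  exists N => m n Nm Nn.
  rewrite -(@ltr_pXn2r _ 2)// ?nnegrE ?rnorm_ge0 ?ltW//.
  apply: (lt_trans (near_min _ _ _ (sP m).1 (sP n).1 (sN m Nm) (sN n Nn))).
  by rewrite mulrC -ltr_pdivlMr.
have Ap : A p by apply: (closed_cvg_mem Acl) sp => n; exact: (sP n).1.
have pd : rnorm (x - p) ^+ 2 <= d.
  have xs : (fun n => rnorm (x - s n) ^+ 2) @ \oo --> rnorm (x - p) ^+ 2.
    have xs : (fun n => rnorm (x - s n)) @ \oo --> rnorm (x - p).
      by apply: cvg_rnorm; apply: cvgB => //; exact: cvg_cst.
    by rewrite [X in _ --> X]expr2; under eq_fun do rewrite expr2; exact: cvgM.
  have ds : (fun n : nat => d + n.+1%:R^-1) @ \oo --> d + 0.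
    by apply: cvgD; [exact: cvg_cst | exact: cvg_harmonic].
  rewrite -[d]addr0; apply: (ler_cvg_to xs ds).
  by apply: nearW => n; exact/ltW/(sP n).2.
exists p; split=> // a Aa.
set q := inner (x - p) a.
(* Compare p with a small displacement towards a; the denominator norm^2 + 1
   stays positive even if a is zero. *)
have /dle : A (p + ((rnorm a ^+ 2 + 1)^-1%:C%C * q) *: a).
  by apply: subspaceD => //; exact: subspaceZ.
rewrite opprD addrA rnormB_phase_sqr -/q => dq.
apply: rnorm_eq0; apply/eqP; rewrite -sqrf_eq0 eq_le sqr_ge0 andbT.
set u := rnorm q ^+ 2 in dq *; set w := rnorm a ^+ 2 in dq *.
have w0 : 0 <= w by exact: sqr_ge0.
have {pd}dq : 2 * (w + 1)^-1 * u <= (w + 1)^-1 ^+ 2 * u * w by lra.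
have : 0 <= ((w + 1)^-1 ^+ 2 * u * w - 2 * (w + 1)^-1 * u) * (w + 1) ^+ 2.
  by rewrite mulr_ge0 ?sqr_ge0// subr_ge0.
have -> : ((w + 1)^-1 ^+ 2 * u * w - 2 * (w + 1)^-1 * u) * (w + 1) ^+ 2 =
    - (u * (w + 2)).
  by field; rewrite gt_eqF// ltr_wpDl.
by rewrite oppr_ge0 pmulr_lle0// ltr_wpDl.
Qed.

End InnerProduct.

(** * Closed subspaces and the open mapping theorem *)

Section ClosedSubspaces.
Variables (R : realType) (H : hilbertType R).
Local Notation C := R[i].
Implicit Types (x y z : H) (A B : set H).

Definition proj A x : H := xget 0 (is_proj A x).

Lemma projP A x : csubspace A -> is_proj A x (proj A x).
Proof. by move=> /(@proj_exists _ _ _ x)[p pP]; apply: xgetPex; exists p. Qed.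

Lemma proj_unique A x p : csubspace A -> is_proj A x p -> proj A x = p.
Proof.
move=> cA [Ap pP]; have [Aq qP] := projP x cA; set q := proj A x in Aq qP *.
have Aqp : A (q - p) by apply: subspaceB => //; case: cA.
apply/eqP; rewrite -subr_eq0; apply/eqP; apply: rnorm_eq0; apply/eqP.
rewrite -sqrf_eq0; apply/eqP/complexI; rewrite -innerxx.
rewrite {1}(_ : q - p = (x - p) - (x - q)); last first.
  by rewrite opprB [RHS]addrC subrKA.
by rewrite innerDl innerNl pP// qP// subrr.
Qed.

Lemma proj_mem A x : csubspace A -> A (proj A x).
Proof. by move=> /(projP x)[]. Qed.

Lemma proj_id A x : csubspace A -> A x -> proj A x = x.
Proof.
move=> cA Ax; apply: proj_unique => //; split=> // a _.
by rewrite subrr linear0l.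
Qed.

Lemma proj_linear A : csubspace A -> linear (proj A).
Proof.
move=> cA a x y; apply: proj_unique => //.
have [[Ax xP] [Ay yP]] := (projP x cA, projP y cA).
split; first exact: cA.1.2.
move=> b Ab; rewrite opprD addrACA -scalerBr innerDl innerZl.
by rewrite xP// yP// mulr0 addr0.
Qed.

Lemma pythagoras_proj A x : csubspace A ->
  rnorm x ^+ 2 = rnorm (proj A x) ^+ 2 + rnorm (x - proj A x) ^+ 2.
Proof.
move=> cA; have [Ax xP] := projP x cA.
by rewrite -pythagoras ?[_ + (x - _)]addrC ?subrK//; apply/inner_eq0C/xP.
Qed.

Lemma rnorm_proj_le A x : csubspace A -> rnorm (proj A x) <= rnorm x.
Proof.
move=> cA; rewrite -(@ler_pXn2r _ 2)// ?nnegrE ?rnorm_ge0//.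
by rewrite (pythagoras_proj x cA) lerDl sqr_ge0.
Qed.

Lemma rnorm_sub_proj_le A x : csubspace A -> rnorm (x - proj A x) <= rnorm x.
Proof.
move=> cA; rewrite -(@ler_pXn2r _ 2)// ?nnegrE ?rnorm_ge0//.
by rewrite (pythagoras_proj x cA) lerDr sqr_ge0.
Qed.

Lemma csubspace_preim (f : H -> H) B :
  linear f -> bounded_op f -> csubspace B -> csubspace (f @^-1` B).
Proof.
move=> fL /bounded_opP[c c0 fc] [[B0 BL] /closed_rnormP Bcl].
split; first by split=> [|a x y]; rewrite /preimage /= ?linear_at0// fL; exact: BL.
apply/closed_rnormP => x xB; apply: Bcl => e e0.
have [|a Ba xa] := xB (e / (c + 1)); first by rewrite divr_gt0// ltr_wpDl.
exists (f a) => //; rewrite -(zmod_morphism_linear fL).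
apply: (le_lt_trans (fc _)); rewrite ltr_pdivlMr ?ltr_wpDl// in xa.
by have := rnorm_ge0 (x - a); nra.
Qed.

Lemma csubspace0 : csubspace [set 0 : H].
Proof.
split; first by split=> // a x y /= -> ->; rewrite scaler0 addr0.
apply/closed_rnormP => x x0; apply: rnorm_eq0; apply/eqP.
rewrite eq_le rnorm_ge0 andbT; apply/ler_addgt0Pl => e /x0[_ -> ].
by rewrite subr0 addr0 => /ltW.
Qed.

Lemma csubspace_ker (f : H -> H) : linear f -> bounded_op f -> csubspace (ker f).
Proof. by move=> fL fB; apply: csubspace_preim => //; exact: csubspace0. Qed.

(** Adding a line keeps a subspace closed: the coefficient along the line can be
    read off continuously, as the inner product with the component of w
    orthogonal to A. *)
Lemma closed_add_line A w :
  csubspace A -> closed [set x | exists a, A (x - a *: w)].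
Proof.
move=> cA; have [Aw wP] := projP w cA; pose v := w - proj A w.
have [v0|v0] := eqVneq v 0.
  have Aw' : A w by move/eqP: v0; rewrite subr_eq0 => /eqP ->.
  rewrite (_ : [set _ | _] = A); first exact: cA.2.
  apply/seteqP; split=> x /=; last by move=> Ax; exists 0; rewrite scale0r subr0.
  move=> [a Axa]; rewrite -(subrK (a *: w) x); apply: subspaceD => //; first exact: cA.1.
  by apply: subspaceZ => //; exact: cA.1.
have vp : 0 < rnorm v by exact: rnorm_gt0.
have coefE x a : A (x - a *: w) -> a = inner x v / inner v v.
  move=> Axa; rewrite -(subrK (a *: w) x) innerDl.
  rewrite (inner_eq0C (wP _ Axa)) add0r innerZl.
  rewrite -(subrK (proj A w) w) -/v innerDl (inner_eq0C (wP _ Aw)) addr0.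
  by rewrite mulfK// innerxx; apply/eqP => /complexI/eqP; rewrite sqrf_eq0 gt_eqF.
have /closed_rnormP Acl := cA.2.
apply/closed_rnormP => x xA; exists (inner x v / inner v v).
pose k := 1 + rnorm w / rnorm v.
have k0 : 0 < k by rewrite ltr_wpDr// divr_ge0 ?rnorm_ge0.
apply: Acl => e e0; have [|y [a Aya] xy] := xA (e / k); first exact: divr_gt0.
exists (y - a *: w) => //; rewrite (coefE _ _ Aya).
rewrite opprD opprK addrACA [- (_ *: w) + _]addrC -scalerBl -mulrBl.
rewrite -innerNl -innerDl; apply: (le_lt_trans (rnormD _ _)).
rewrite rnormZ rnormM rnormV innerxx rnorm_real ger0_norm ?sqr_ge0//.
have := cauchy_schwarz (y - x) v; rewrite (rnorm_distC y) => ivx.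
rewrite ltr_pdivlMr// in xy; apply: le_lt_trans xy.
rewrite /k mulrDr mulr1 lerD2l [leRHS]mulrA [leRHS]mulrAC ler_wpM2r ?rnorm_ge0//.
rewrite ler_pdivrMr ?exprn_gt0//.
by apply: (le_trans ivx); rewrite expr2 mulrA divfK ?gt_eqF.
Qed.

(** Baire category inside a closed set: the alternative would produce nested
    balls, shrinking geometrically, whose common point escapes every E n. *)
Lemma baire_closed B (E : nat -> set H) :
  closed B -> B !=set0 -> (forall n, closed (E n)) -> B `<=` \bigcup_n E n ->
  exists n y (r : R), [/\ B y, 0 < r &
    forall z, B z -> rnorm (z - y) < r -> E n z].
Proof.
move=> Bcl [b0 Bb0] Ecl BE; apply: contrapT => nE.
have /choice[f fP] : forall np : nat * (H * R), exists q : H * R,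
    B np.2.1 -> 0 < np.2.2 ->
    [/\ B q.1, 0 < q.2, q.2 <= np.2.2 / 2, rnorm (q.1 - np.2.1) < np.2.2 &
        forall z, rnorm (z - q.1) <= 2 * q.2 -> ~ E np.1 z].
  move=> [n [y r]] /=; have [By|] := pselect (B y); last by exists (0, 0).
  have [r0|] := ltP 0 r; last by exists (0, 0).
  have [z [Bz zy nEz]] : exists z, [/\ B z, rnorm (z - y) < r & ~ E n z].
    apply: contrapT => nz; apply: nE; exists n, y, r; split=> // z Bz zy.
    by apply: contrapT => nEz; apply: nz; exists z.
  have [e e0 eE] : exists2 e : R, 0 < e & forall w, rnorm (z - w) < e -> ~ E n w.
    apply: contrapT => ne; apply: nEz; apply: (iffLR (closed_rnormP _) (Ecl n)) => e e0.
    apply: contrapT => nw; apply: ne; exists e => // w zw Ew.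
    by apply: nw; exists w.
  (* With radii halved at each step, all later centres stay within twice the
     current radius, a distance at which E n is avoided. *)
  pose m := Num.min (r / 2) (e / 4); exists (z, m); split=> //=.
  - by rewrite lt_min !divr_gt0.
  - by rewrite ge_min lexx.
  - move=> w zw; apply: eE; rewrite rnorm_distC; apply: le_lt_trans zw _.
    have : m <= e / 4 by rewrite ge_min lexx orbT.
    by move=> me; lra.
pose p n := iteri n (fun k q => f (k, q)) (b0, 1).
have pS n : p n.+1 = f (n, p n) by [].
have pP n : B (p n).1 /\ 0 < (p n).2.
  elim: n => [|n [Bp p0]]; first by split=> //=; exact: ltr01.
  by rewrite pS; have [] := fP (n, p n) Bp p0.
have pSP n : [/\ (p n.+1).2 <= (p n).2 / 2, rnorm ((p n.+1).1 - (p n).1) < (p n).2 &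
    forall z, rnorm (z - (p n.+1).1) <= 2 * (p n.+1).2 -> ~ E n z].
  by rewrite pS; have [] := fP (n, p n) (pP n).1 (pP n).2.
have r_le n k : (p (k + n)%N).2 <= (p n).2 / 2 ^+ k.
  elim: k => [|k IH]; first by rewrite expr0 divr1.
  have [+ _ _] := pSP (k + n)%N; rewrite addSn => /le_trans; apply.
  by rewrite exprSr invfM mulrA ler_wpM2r.
have p_lim n : exists2 l, (fun k => (p (k + n)%N).1) @ \oo --> l &
    rnorm (l - (p n).1) <= 2 * (p n).2.
  have [|l pl /(_ 0%N)] := @geometric_cvg _ _ (fun k => (p (k + n)%N).1) (p n).2.
    move=> k; apply: le_trans (r_le n k).
    by have [_ + _] := pSP (k + n)%N; rewrite addSn; exact: ltW.
  by rewrite expr0 divr1 => ln; exists l.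
have [l pl _] := p_lim 0%N.
have Bl : B l by apply: (closed_cvg_mem Bcl) pl => k; exact: (pP _).1.
have [n _ En] := BE _ Bl.
have [l' pl' ln] := p_lim n.+1.
have l'E : l' = l.
  move: pl; rewrite (@cvg_shiftn 0 _ (fun k => (p k).1)) -(cvg_shiftn n.+1).
  exact: cvg_unique.
by have [_ _ /(_ l)] := pSP n; apply=> //; rewrite -l'E.
Qed.

Section OpenMapping.
Variables (T : H -> H) (A B : set H).
Hypotheses (T_linear : linear T) (T_bounded : bounded_op T).
Hypotheses (cA : csubspace A) (cB : csubspace B).
Hypothesis T_onto : forall y, B y -> exists2 x, A x & T x = y.
Hypothesis T_into : forall x, A x -> B (T x).

Let T_sub x y : T (x - y) = T x - T y.
Proof. exact: (zmod_morphism_linear T_linear). Qed.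

Let T0 : T 0 = 0.
Proof. exact: linear_at0. Qed.

Let TD x y : T (x + y) = T x + T y.
Proof. by have := T_linear 1 x y; rewrite !scale1r. Qed.

Let TZ a x : T (a *: x) = a *: T x.
Proof. exact: (scalable_linear T_linear). Qed.

(** Baire category gives a ball on which approximate preimages of bounded size
    exist; differences recentre the ball at 0, and rescaling reaches every y. *)
Lemma open_mapping_approx : exists2 c : R, 0 <= c & forall y, B y ->
  exists x, [/\ A x, rnorm x <= c * rnorm y & rnorm (y - T x) <= rnorm y / 2].
Proof.
pose E n := [set y | forall e : R, 0 < e ->
  exists x, [/\ A x, rnorm x <= n%:R & rnorm (y - T x) < e]].
have Ecl n : closed (E n).
  apply/closed_rnormP => y yE e e0.
  have e2 : 0 < e / 2 by rewrite divr_gt0.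
  have [z /(_ _ e2)[x [Ax xn zx]] yz] := yE _ e2; exists x; split=> //.
  apply: (le_lt_trans (rnorm_distD z _ _)).
  by rewrite [e]splitr ltrD.
have [] := @baire_closed B E cB.2 _ Ecl.
- by exists 0; exact: cB.1.1.
- move=> y /T_onto[x Ax xy]; exists (Num.truncn (rnorm x)).+1 => // e e0.
  by exists x; split=> //; [exact/ltW/truncnS_gt | rewrite xy subrr rnorm0].
move=> n [y0 [r [By0 r0 rE]]].
exists (4 * n%:R / r) => [|y By].
  by apply: divr_ge0; [exact: mulr_ge0 | exact: ltW].
have [->|y_neq0] := eqVneq y 0.
  exists 0; rewrite T0 subrr rnorm0 mulr0 mul0r.
  by split=> //; exact: cA.1.1.
have yp := rnorm_gt0 y_neq0.
pose t := r / (2 * rnorm y).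
have t0 : 0 < t by rewrite divr_gt0// mulr_gt0.
have r8 : 0 < r / 8 by rewrite divr_gt0.
have ny : rnorm (t%:C%C *: y) = r / 2.
  by rewrite rnormZ rnorm_real gtr0_norm// /t; field; rewrite gt_eqF.
have [|||x1 [Ax1 x1n yx1]] := rE (t%:C%C *: y + y0) _ _ (r / 8) => //.
- exact: cB.1.2.
- by rewrite addrK ny; lra.
have [|x2 [Ax2 x2n yx2]] := rE y0 By0 _ _ r8; first by rewrite subrr rnorm0.
have xn : rnorm (x1 - x2) <= 2 * n%:R by have := rnormB x1 x2; lra.
have yx : rnorm (t%:C%C *: y - T (x1 - x2)) < r / 4.
  have -> : t%:C%C *: y - T (x1 - x2) =
      (t%:C%C *: y + y0 - T x1) - (y0 - T x2).
    rewrite T_sub !opprB [RHS]addrACA [RHS]addrA [RHS]addrAC.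
    by rewrite [_ + y0 + _]addrAC addrK addrA.
  by have := rnormB (t%:C%C *: y + y0 - T x1) (y0 - T x2); lra.
have tV : rnorm (t^-1%:C%C : C) = t^-1 by rewrite rnorm_real gtr0_norm ?invr_gt0.
exists (t^-1%:C%C *: (x1 - x2)); split.
- by apply: subspaceZ; [exact: cA.1 | apply: subspaceB => //; exact: cA.1].
- rewrite rnormZ tV.
  have -> : 4 * n%:R / r * rnorm y = t^-1 * (2 * n%:R).
    by rewrite /t; field; rewrite !gt_eqF.
  by rewrite ler_wpM2l// invr_ge0 ltW.
- have -> : y - T (t^-1%:C%C *: (x1 - x2)) =
      t^-1%:C%C *: (t%:C%C *: y - T (x1 - x2)).
    rewrite TZ scalerBr scalerA -rmorphM /= mulVf ?gt_eqF//.
    by rewrite scale1r.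
  rewrite rnormZ tV.
  have -> : rnorm y / 2 = t^-1 * (r / 4).
    by rewrite /t; field; rewrite !gt_eqF.
  by apply: ler_wpM2l; [rewrite invr_ge0 ltW | exact: ltW].
Qed.

(** Solving approximately again for the remaining error halves it each time, so
    the corrections add up to an exact preimage. *)
Lemma open_mapping : exists2 c : R, 0 <= c & forall y, B y ->
  exists x, [/\ A x, T x = y & rnorm x <= c * rnorm y].
Proof.
have [c c0 cP] := open_mapping_approx.
have /choice[f fP] : forall y, exists x, B y ->
    [/\ A x, rnorm x <= c * rnorm y & rnorm (y - T x) <= rnorm y / 2].
  move=> y; have [By|] := pselect (B y); last by exists 0.
  by have [x xP] := cP y By; exists x.
exists (2 * c) => [|y By]; first by rewrite mulr_ge0.
pose u n := iter n (fun x => x + f (y - T x)) 0.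
have Au n : A (u n).
  elim: n => [|n IH]; first exact: cA.1.1.
  apply: subspaceD => //; first exact: cA.1.
  have [] // := fP (y - T (u n)).
  by apply: subspaceB => //; [exact: cB.1 | exact: T_into].
have Bu n : B (y - T (u n)).
  by apply: subspaceB => //; [exact: cB.1 | exact: T_into].

have resid n : rnorm (y - T (u n)) <= rnorm y / 2 ^+ n.
  elim: n => [|n IH]; first by rewrite /= T0 subr0 expr0 divr1.
  have [_ _ fn] := fP _ (Bu n).
  have -> : y - T (u n.+1) = y - T (u n) - T (f (y - T (u n))).
    by rewrite /= TD opprD addrA.
  by apply: (le_trans fn); rewrite exprSr invfM mulrA ler_wpM2r.
have [|l ul /(_ 0%N)] := @geometric_cvg _ _ u (c * rnorm y).
  move=> n; have [_ fn _] := fP _ (Bu n).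
  rewrite /= addrC addKr; apply: (le_trans fn).
  by rewrite -mulrA ler_wpM2l.
rewrite subr0 expr0 divr1 mulrA => lc; exists l; split=> //.
  exact: closed_cvg_mem cA.2 Au ul.
have Tul := bounded_cvg T_linear T_bounded ul.
apply: (cvg_unique _ Tul) => //.
apply/cvg_rnormP => e e0.
have [N Ne] := geometric_small (rnorm y) e0.
exists N => n Nn; apply: le_lt_trans Ne; apply: (le_trans (resid n)).
by rewrite ler_wpM2l ?rnorm_ge0// lef_pV2 ?posrE ?exprn_gt0// ler_eXn2l// ltr1n.
Qed.

(** The right inverse picks the preimage orthogonal to the kernel, which makes
    the choice linear without enlarging the bound. *)
Lemma bounded_right_inverse : exists V : H -> H,
  [/\ linear V, bounded_op V, forall y, A (V y) & forall y, B y -> T (V y) = y].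
Proof.
have [c c0 cP] := open_mapping.
have /choice[g gP] : forall y, exists x, B y ->
    [/\ A x, T x = y & rnorm x <= c * rnorm y].
  move=> y; have [By|] := pselect (B y); last by exists 0.
  by have [x xP] := cP y By; exists x.
pose K := ker T `&` A.
have cK : csubspace K by apply: csubspaceI => //; exact: csubspace_ker.
have gB y := gP (proj B y) (proj_mem y cB).
pose V y := g (proj B y) - proj K (g (proj B y)).
have projKB x y : proj K x - proj K y = proj K (x - y).
  by rewrite (zmod_morphism_linear (proj_linear cK)).
have VE x y : A x -> T x = proj B y -> V y = x - proj K x.
  move=> Ax Txy; have [Ag Tg _] := gB y; apply/eqP.
  rewrite -subr_eq0 /V opprD addrACA -opprD projKB (@proj_id K) ?subrr//.
  by split; [rewrite /ker /preimage /= T_sub Tg Txy subrr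
    | apply: subspaceB => //; exact: cA.1].
have VA y : A (V y).
  have [Ag _ _] := gB y.
  by apply: subspaceB => //; [exact: cA.1 | exact: (proj_mem _ cK).2].
have TV y : T (V y) = proj B y.
  have [_ Tg _] := gB y; have [Tk _] := proj_mem (g (proj B y)) cK.
  by rewrite /V T_sub Tg [T (proj _ _)]Tk subr0.
have VK y : proj K (V y) = 0.
  by rewrite /V -projKB [X in _ - X]proj_id ?subrr//; exact: proj_mem.
exists V; split=> //.
- move=> a x y; rewrite (VE (a *: V x + V y)).
  + by rewrite proj_linear// !VK scaler0 addr0 subr0.
  + exact: cA.1.2.
  + by rewrite T_linear !TV proj_linear.
- apply/bounded_opP; exists c => // y; have [_ _ gc] := gB y.
  apply: (le_trans (rnorm_sub_proj_le _ cK)); apply: (le_trans gc).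
  by rewrite ler_wpM2l// rnorm_proj_le.
- by move=> y By; rewrite TV proj_id.
Qed.

End OpenMapping.
End ClosedSubspaces.

(** * Orthonormal systems and isometric embeddings *)

Section OrthonormalSystems.
Variables (R : realType) (H : hilbertType R).
Local Notation C := R[i].
Implicit Types (x y z : H) (M : set H) (e u v : nat -> H) (s : seq H).

(** Zero vectors are allowed: Gram-Schmidt then applies to every sequence,
    dependent ones included. *)
Definition orthonormal_or_zero e :=
  (forall m n, (m < n)%N -> inner (e n) (e m) = 0) /\
  (forall n, e n = 0 \/ rnorm (e n) = 1).

Definition gram_schmidt_step s x : H :=
  let r := x - \sum_(w <- s) inner x w *: w in (rnorm r)^-1%:C%C *: r.

(** The next vector to process may depend on the system built so far: this covers
    both a prescribed sequence and a choice outside the current span. *)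
Definition gram_schmidt_seq (next : seq H -> H) n : seq H :=
  iter n (fun s => rcons s (gram_schmidt_step s (next s))) [::].

Definition gram_schmidt (next : seq H -> H) n : H :=
  gram_schmidt_step (gram_schmidt_seq next n) (next (gram_schmidt_seq next n)).

Lemma gram_schmidt_seqE next n :
  gram_schmidt_seq next n = mkseq (gram_schmidt next) n.
Proof. by elim: n => // n IH; rewrite mkseqS -IH. Qed.

Lemma gram_schmidt_stepE s x :
  x = (rnorm (x - \sum_(w <- s) inner x w *: w))%:C%C *: gram_schmidt_step s x
      + \sum_(w <- s) inner x w *: w.
Proof.
rewrite /gram_schmidt_step /=; set r := x - _; rewrite scalerA -rmorphM /=.
have [r0|r0] := eqVneq r 0.
  by rewrite r0 scaler0 add0r; apply/eqP; rewrite -subr_eq0 -/r r0.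
by rewrite divff ?gt_eqF ?rnorm_gt0// scale1r subrK.
Qed.

Lemma orthonormal_or_zero_absorb e x n : orthonormal_or_zero e ->
  inner x (e n) * inner (e n) (e n) = inner x (e n).
Proof.
move=> [_ /(_ n)[->|en]]; first by rewrite linear0r mul0r.
by rewrite innerxx en expr1n mulr1.
Qed.

Lemma inner_suml (I : Type) (r : seq I) (P : pred I) (F : I -> H) x :
  inner (\sum_(i <- r | P i) F i) x = \sum_(i <- r | P i) inner (F i) x.
Proof. exact: linear_sumlz. Qed.

Lemma inner_partial_sum e x n k : orthonormal_or_zero e -> (k < n)%N ->
  inner (\sum_(0 <= i < n) inner x (e i) *: e i) (e k) = inner x (e k).
Proof.
move=> eo kn; rewrite inner_suml (big_rem k) ?mem_index_iota//=.
rewrite innerZl orthonormal_or_zero_absorb// big_seq big1 ?addr0// => i.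
rewrite rem_filter ?iota_uniq// mem_filter /= => /andP[ik _].
rewrite innerZl; have [lt_ik|lt_ki|ik'] := ltngtP i k; last by rewrite ik' eqxx in ik.
  by rewrite (inner_eq0C (eo.1 _ _ lt_ik)) mulr0.
by rewrite eo.1 ?mulr0.
Qed.

Lemma gram_schmidtP next : orthonormal_or_zero (gram_schmidt next).
Proof.
set e := gram_schmidt next.
have e01 n : e n = 0 \/ rnorm (e n) = 1.
  rewrite /e /gram_schmidt /gram_schmidt_step /=; set r := _ - _.
  have [->|r0] := eqVneq r 0; [left | right]; first by rewrite scaler0.
  by rewrite rnormZ rnorm_real gtr0_norm ?invr_gt0 ?rnorm_gt0// mulVf ?gt_eqF ?rnorm_gt0.
split=> // m n; elim/ltn_ind: n m => n IH m mn.
(* The vectors from position n on are replaced by zero so that the induction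
   hypothesis speaks of an orthonormal system. *)
pose e' k := if (k < n)%N then e k else 0.
have eo' : orthonormal_or_zero e'.
  split=> [i j ij|k]; rewrite /e'; last by case: ifP => _; [exact: e01 | left].
  case: ifP => jn; last by rewrite linear0l.
  by rewrite (ltn_trans ij jn); exact: IH.
have -> : e n = gram_schmidt_step (mkseq e n) (next (mkseq e n)).
  by rewrite -gram_schmidt_seqE.
rewrite /gram_schmidt_step /= innerZl big_map.
set x := next _; rewrite innerDl innerNl.
have -> : \sum_(i <- iota 0 n) inner x (e i) *: e i =
    \sum_(0 <= i < n) inner x (e' i) *: e' i.
  by rewrite /index_iota subn0 !big_seq; apply: eq_bigr => i;
     rewrite mem_iota add0n /e' => /andP[_ ->].
have em : e m = e' m by rewrite /e' mn.
by rewrite em (inner_partial_sum _ eo' mn) subrr mulr0.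
Qed.

(** With the span of the output as M, the process loses nothing of the sequence
    that is fed to it. *)
Lemma gram_schmidt_span next M n :
  subspace M -> (forall k, (k <= n)%N -> M (gram_schmidt next k)) ->
  M (next (gram_schmidt_seq next n)).
Proof.
move=> Msub Me; set s := gram_schmidt_seq next n.
rewrite (gram_schmidt_stepE s (next s)); apply: subspaceD => //.
  by apply: subspaceZ => //; exact: Me.
rewrite [in \sum_(w <- s) _]/s gram_schmidt_seqE big_map big_seq.
apply: subspace_sum => // i; rewrite mem_iota add0n => /andP[_ iN].
by apply: subspaceZ => //; exact/Me/ltnW.
Qed.

Lemma rnorm_partial_sum_sqr u (c : nat -> C) m n : orthonormal_or_zero u ->
  rnorm (\sum_(m <= i < n) c i *: u i) ^+ 2 =
  \sum_(m <= i < n) rnorm (c i) ^+ 2 * rnorm (u i) ^+ 2.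
Proof.
move=> uo; have [nm|mn] := leqP n m.
  by rewrite !big_geq// rnorm0 expr0n.
elim: n mn => // n IH; rewrite ltnS leq_eqVlt => /orP[/eqP ->|mn].
  by rewrite !big_nat1 rnormZ exprMn.
rewrite !(big_nat_recr n) ?(ltnW mn)//= pythagoras ?IH// ?rnormZ ?exprMn//.
rewrite inner_suml big_nat big1// => i /andP[_ iN].
by rewrite innerZl innerZr (inner_eq0C (uo.1 _ _ iN)) !mulr0.
Qed.

Lemma rnorm_partial_sum e u x m n :
  orthonormal_or_zero e -> orthonormal_or_zero u -> (forall k, rnorm (u k) = 1) ->
  rnorm (\sum_(m <= i < n) inner x (e i) *: u i) =
  rnorm (\sum_(m <= i < n) inner x (e i) *: e i).
Proof.
move=> eo uo u1; apply/eqP; rewrite -(@eqrXn2 _ 2) ?rnorm_ge0//; apply/eqP.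
rewrite !rnorm_partial_sum_sqr//; apply: eq_bigr => k _.
rewrite u1; have [->|->//] := eo.2 k.
by rewrite linear0r !rnorm0 expr0n !mul0r.
Qed.

Definition complete_system e := orthonormal_or_zero e /\
  forall x, (fun n => \sum_(0 <= i < n) inner x (e i) *: e i) @ \oo --> x.

(** The vectors that are the limit of their expansion form a closed subspace,
    because x minus its partial sums is never longer than x. *)
Lemma dense_complete_system e : orthonormal_or_zero e ->
  dense (lin_span (range e)) -> complete_system e.
Proof.
move=> eo ed; split=> //.
pose F n x := \sum_(0 <= i < n) inner x (e i) *: e i.
have FL n : linear (F n).
  move=> a x y; rewrite /F scaler_sumr -big_split; apply: eq_bigr => i _ /=.
  by rewrite innerDl innerZl scalerDl scalerA.
have F_le n x : rnorm (x - F n x) <= rnorm x.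
  rewrite -(@ler_pXn2r _ 2)// ?nnegrE ?rnorm_ge0//.
  rewrite -[in leRHS](subrK (F n x) x) [leRHS]pythagoras ?lerDl ?sqr_ge0//.
  apply: inner_eq0C; rewrite {1}/F inner_suml big_nat big1// => i /andP[_ iN].
  rewrite innerZl [inner (e i) _]inner_eq0C ?mulr0//.
  by rewrite innerDl innerNl inner_partial_sum// subrr.
pose G := [set x | F^~ x @ \oo --> x].
have Gs : subspace G.
  split; rewrite /G /=.
    suff -> : F^~ 0 = cst 0 by exact: cvg_cst.
    by apply/funext => n; rewrite (linear_at0 (FL n)).
  move=> a x y Gx Gy; under eq_fun do rewrite FL.
  by apply: cvgD => //; exact: cvgZr.
have Gcl : closed G.
  apply/closed_rnormP => x xG; apply/cvg_rnormP => d d0.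
  have d2 : 0 < d / 2 by rewrite divr_gt0.
  have [a /cvg_rnormP/(_ _ d2)[N aN] xa] := xG _ d2.
  exists N => n /aN {}aN; apply: (le_lt_trans (y := rnorm (x - a) + rnorm (a - F n a))).
    apply: le_trans (lerD (F_le n (x - a)) (lexx _)).
    rewrite (zmod_morphism_linear (FL n)).
    apply: le_trans _ (rnormD _ _).
    by rewrite opprB [_ + _ + (a - _)]addrACA subrK [F n a - _ - _]addrAC subrr add0r.
  by rewrite [d]splitr ltrD.
have Ge k : G (e k).
  apply/cvg_rnormP => d d0; exists k.+1 => n kn.
  suff -> : F n (e k) = e k by rewrite subrr rnorm0.
  rewrite /F (big_rem k) ?mem_index_iota//= big_seq big1 ?addr0 => [|i].
    have [ek|ek] := eo.2 k; first by rewrite ek scaler0.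
    by rewrite innerxx ek expr1n scale1r.
  rewrite rem_filter ?iota_uniq// mem_filter /= => /andP[ik _].
  have [lt_ik|lt_ki|ik'] := ltngtP i k; last by rewrite ik' eqxx in ik.
    by rewrite (eo.1 _ _ lt_ik) scale0r.
  by rewrite (inner_eq0C (eo.1 _ _ lt_ki)) scale0r.
have GT : G = setT.
  apply: (dense_sub_closed ed Gcl); apply: lin_span_min => // _ [k _ <-].
  exact: Ge.
by move=> x; have : G x by rewrite GT.
Qed.

(** Sending one system to another preserves the norms of all partial sums, so
    convergence of the expansion of x carries over to its image. *)
Lemma isometry_exists e u M :
  complete_system e -> orthonormal_or_zero u -> (forall k, rnorm (u k) = 1) ->
  csubspace M -> (forall k, M (u k)) ->
  exists W : H -> H,
    [/\ linear W, forall x, rnorm (W x) = rnorm x & forall x, M (W x)].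
Proof.
move=> [eo ec] uo u1 [Ms Mcl] Mu.
pose F n x := \sum_(0 <= i < n) inner x (e i) *: e i.
pose G n x := \sum_(0 <= i < n) inner x (e i) *: u i.
have GF m n x : rnorm (G n x - G m x) = rnorm (F n x - F m x).
  wlog mn : m n / (m <= n)%N => [hw|].
    have [/hw//|/ltnW/hw nm] := leqP m n.
    by rewrite rnorm_distC nm rnorm_distC.
  rewrite /G /F !(big_cat_nat (leq0n m) mn)/= ![_ + _ - _]addrAC !subrr !add0r.
  exact: rnorm_partial_sum.
have /choice[W WP] : forall x, exists w : H, G^~ x @ \oo --> w.
  move=> x; apply: cauchy_rnorm_cvg => d d0.
  have d2 : 0 < d / 2 by rewrite divr_gt0.
  have /cvg_rnormP/(_ _ d2)[N xN] := ec x.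
  exists N => m n /xN xm /xN xn; rewrite GF rnorm_distC.
  apply: (le_lt_trans (rnorm_distD x _ _)).
  by rewrite [d]splitr rnorm_distC ltrD.
exists W; split.
- move=> a x y; apply: (cvg_unique _ (WP (a *: x + y))) => //.
  rewrite (_ : G^~ _ = fun n => a *: G n x + G n y); last first.
    apply/funext => n; rewrite /G scaler_sumr -big_split; apply: eq_bigr => i _ /=.
    by rewrite innerDl innerZl scalerDl scalerA.
  by apply: cvgD => //; exact: cvgZr.
- move=> x; have := cvg_rnorm (WP x); have := cvg_rnorm (ec x).
  rewrite (_ : (fun n => rnorm (G n x)) = (fun n => rnorm (F n x))).
    by move=> h1 h2; apply: cvg_unique h2 h1.
  apply/funext => n; have := GF 0%N n x.
  by rewrite [G 0%N x]big_geq// [F 0%N x]big_geq// !subr0.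
- move=> x; apply: (closed_cvg_mem Mcl) (WP x) => n.
  by apply: subspace_sum => // i _; exact: subspaceZ.
Qed.

Lemma infinite_dim_orthonormal M : subspace M -> ~ finite_dim M ->
  exists u, [/\ orthonormal_or_zero u, forall k, rnorm (u k) = 1 &
    forall k, M (u k)].
Proof.
move=> Ms Minf.
have /choice[next nextP] : forall s, exists x,
    [set` s] `<=` M -> M x /\ ~ lin_span [set` s] x.
  move=> s; have [sM|] := pselect ([set` s] `<=` M); last by exists 0.
  apply: contrapT => nx; apply: Minf; exists s; apply/seteqP; split.
    by move=> x Mx; apply: contrapT => nsx; apply: nx; exists x.
  exact: lin_span_min.
pose u := gram_schmidt next; have uo : orthonormal_or_zero u by exact: gram_schmidtP.
have uS n : u n = gram_schmidt_step (mkseq u n) (next (mkseq u n)).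
  by rewrite -gram_schmidt_seqE.
have sM n : [set` mkseq u n] `<=` M.
  elim: n => [x|n IH x]; first by rewrite /= in_nil.
  rewrite /= mkseqS mem_rcons inE => /orP[/eqP ->|/IH//].
  rewrite uS; have [Mx _] := nextP _ IH.
  apply: subspaceZ => //; apply: subspaceB => //.
  rewrite big_seq; apply: subspace_sum => // i /IH Mi.
  exact: subspaceZ.
have Mu k : M (u k) by apply: (sM k.+1); rewrite /= mkseqS mem_rcons mem_head.
exists u; split=> // k; have [uk0|//] := uo.2 k.
have [_ []] := nextP _ (sM k).
rewrite [next _](gram_schmidt_stepE (mkseq u k)) -uS uk0 scaler0 add0r big_seq.
apply: subspace_sum => [|i iu]; first exact: lin_span_subspace.
by apply: subspaceZ; [exact: lin_span_subspace | exact: sub_lin_span].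
Qed.

Lemma complete_system_exists v :
  dense (lin_span (range v)) -> exists e, complete_system e.
Proof.
move=> vd; pose next s := v (size s); pose e := gram_schmidt next.
exists e; apply: dense_complete_system; first exact: gram_schmidtP.
move=> D D0 Dop; have [x [Dx vx]] := vd D D0 Dop; exists x; split=> //.
apply: lin_span_min vx; first exact: lin_span_subspace.
move=> _ [n _ <-].
have := @gram_schmidt_span next (lin_span (range e)) n.
rewrite /next gram_schmidt_seqE size_mkseq; apply; first exact: lin_span_subspace.
by move=> k _; apply: sub_lin_span; exists k.
Qed.

End OrthonormalSystems.

(** * Intertwining an arbitrary operator *)

Section Caradus.
Variables (R : realType) (H : hilbertType R).
Local Notation C := R[i].
Variables (T A V W : H -> H) (M : set H).
Hypotheses (T_linear : linear T) (T_bounded : bounded_op T).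
Hypotheses (A_linear : linear A) (A_bounded : bounded_op A).
Hypotheses (V_linear : linear V) (V_bounded : bounded_op V).
Hypotheses (W_linear : linear W) (W_isometry : forall x, rnorm (W x) = rnorm x).
Hypothesis cM : csubspace M.
Hypotheses (V_mem : forall y, M (V y)) (TV : forall y, M y -> T (V y) = y).
Hypotheses (W_mem : forall x, M (W x)) (TW : forall x, T (W x) = 0).

(** X is the sum of the series of the a^n V^n W A^n, which converges once a is
    small compared with the norms of V and A; its partial sums S n satisfy the
    recursion S (n + 1) = W + a V (S n) A, and the limit inherits the corresponding
    fixed-point equation. *)
Lemma caradus_series : exists (a : C) (X : H -> H),
  [/\ a != 0, linear X, bounded_op X, forall x, M (X x) &
      forall x, X x = W x + a *: V (X (A x))].
Proof.
have [/bounded_opP[cV cV0 VP] /bounded_opP[cA cA0 AP]] := (V_bounded, A_bounded).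
(* This scalar makes the ratio t * cV * cA of the series at most 1/2. *)
pose t := (2 * (cV * cA + 1))^-1.
have VA0 : 0 <= cV * cA by rewrite mulr_ge0.
have t0 : 0 < t by rewrite invr_gt0 mulr_gt0// ltr_wpDl.
have tVA : t * (cV * cA) <= 2^-1.
  by rewrite /t invfM -mulrA ler_piMr// mulrC ler_pdivrMr ?mul1r ?lerDl// ltr_wpDl.
pose a : C := t%:C%C.
pose S n := iter n (fun (F : H -> H) x => W x + a *: V (F (A x))) (fun=> 0).
have SL n : linear (S n).
  elim: n => [|n IH] b x y /=; first by rewrite scaler0 addr0.
  rewrite W_linear A_linear IH V_linear !scalerDr !scalerA addrACA [a * b]mulrC.
  by rewrite -!scalerA.
have SM n x : M (S n x).
  elim: n x => [|n IH] x /=; first exact: cM.1.1.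
  apply: subspaceD => //; first exact: cM.1.
  by apply: subspaceZ => //; exact: cM.1.
have Sstep n x : rnorm (S n.+1 x - S n x) <= rnorm x / 2 ^+ n.
  elim: n x => [|n IH] x.
    by rewrite /= (linear_at0 V_linear) scaler0 addr0 subr0 W_isometry expr0 divr1.
  have -> : S n.+2 x - S n.+1 x = a *: V (S n.+1 (A x) - S n (A x)).
    rewrite (zmod_morphism_linear V_linear) scalerBr /=.
    by rewrite opprD addrACA subrr add0r.
  rewrite rnormZ rnorm_real gtr0_norm//.
  apply: le_trans (ler_wpM2l (ltW t0) (VP _)) _.
  apply: le_trans (ler_wpM2l (ltW t0) (ler_wpM2l cV0 (IH _))) _.
  have n2 : 0 <= (2 ^+ n)^-1 :> R by rewrite invr_ge0 exprn_ge0.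
  apply: le_trans (ler_wpM2l (ltW t0) (ler_wpM2l cV0 (ler_wpM2r n2 (AP _)))) _.
  rewrite (_ : t * _ = (t * (cV * cA)) * (rnorm x / 2 ^+ n)); last by ring.
  have -> : rnorm x / 2 ^+ n.+1 = 2^-1 * (rnorm x / 2 ^+ n).
    by rewrite exprSr invfM mulrA mulrC.
  by rewrite ler_wpM2r// mulr_ge0// rnorm_ge0.
have /choice[X XP] : forall x, exists l : H, S^~ x @ \oo --> l /\
    rnorm l <= 2 * rnorm x.
  move=> x; have [l Sl /(_ 0%N)] := geometric_cvg (fun n => Sstep n x).
  by rewrite /= subr0 expr0 divr1 => lx; exists l.
exists a, X; split.
- by apply/eqP => /complexI/eqP; rewrite gt_eqF.
- move=> b x y; apply: (cvg_unique _ (XP (b *: x + y)).1) => //.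
  rewrite (_ : S^~ _ = fun n => b *: S n x + S n y); last first.
    by apply/funext => n; exact: SL.
  by apply: cvgD; [apply: cvgZr; exact: (XP x).1 | exact: (XP y).1].
- by apply/bounded_opP; exists 2 => // x; exact: (XP x).2.
- by move=> x; exact: (closed_cvg_mem cM.2 (fun n => SM n x) (XP x).1).
- move=> x; have := (XP x).1; rewrite -(cvg_shiftn 1) => XPx.
  apply: (cvg_unique _ XPx) => //.
  rewrite (_ : (fun n => S (n + 1)%N x) = fun n => W x + a *: V (S n (A x))); last first.
    by apply/funext => n; rewrite addn1.
  apply: cvgD; first exact: cvg_cst.
  apply: cvgZr; exact: (bounded_cvg V_linear V_bounded (XP (A x)).1).
Qed.

(** Applying T to the functional equation of X removes both W and V, which
    leaves T X = a X A; and W x = X x - V (T (X x)) recovers x, which makes X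
    bounded below. *)
Lemma caradus : exists (a : C) (X : H -> H),
  [/\ a != 0, linear X, bounded_op X, forall x, T (X x) = a *: X (A x) &
      exists2 c : R, 0 <= c & forall x, rnorm x <= c * rnorm (X x)].
Proof.
have [a [X [a0 XL Xb XM XE]]] := caradus_series.
have TX x : T (X x) = a *: X (A x).
  have TD u v : T (u + v) = T u + T v by have := T_linear 1 u v; rewrite !scale1r.
  by rewrite XE TD TW add0r (scalable_linear T_linear) TV.
exists a, X; split=> //.
have [/bounded_opP[cV cV0 VP] /bounded_opP[cT cT0 TP]] := (V_bounded, T_bounded).
exists (1 + cV * cT) => [|x]; first by rewrite addr_ge0 ?mulr_ge0.
rewrite -[leLHS]W_isometry.
have -> : W x = X x - V (T (X x)).
  by rewrite TX (scalable_linear V_linear) [X in X - _]XE addrK.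
apply: (le_trans (rnormB _ _)); rewrite mulrDl mul1r lerD2l.
by apply: (le_trans (VP _)); rewrite -mulrA ler_wpM2l.
Qed.

End Caradus.

Section BoundedBelow.
Variables (R : realType) (H : hilbertType R).

Lemma closed_range_bounded_below (X : H -> H) (c : R) :
  linear X -> bounded_op X -> 0 <= c ->
  (forall x, rnorm x <= c * rnorm (X x)) -> closed (range X).
Proof.
move=> XL Xb c0 XB; apply/closed_rnormP => y yX.
have pow_gt0 n : 0 < (2 ^+ n)^-1 :> R by rewrite invr_gt0 exprn_gt0.
have /choice[s sP] : forall n : nat, exists x, rnorm (y - X x) < (2 ^+ n)^-1.
  by move=> n; have [_ [x _ <-]] := yX _ (pow_gt0 n); exists x.
have [n|l sl _] := @geometric_cvg _ _ s (2 * c).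
  apply: (le_trans (XB _)); rewrite (zmod_morphism_linear XL) [2 * c]mulrC -mulrA.
  rewrite ler_wpM2l//; apply: (le_trans (rnorm_distD y _ _)).
  rewrite mulr_natl mulr2n; apply: lerD; last exact/ltW/sP.
  rewrite rnorm_distC; apply/ltW/(lt_le_trans (sP _)).
  by rewrite lef_pV2 ?posrE ?exprn_gt0// ler_eXn2l// ltr1n.
exists l => //; apply: (cvg_unique _ (bounded_cvg XL Xb sl)) => //.
apply/cvg_rnormP => e e0; have [N Ne] := geometric_small 1 e0.
exists N => n Nn; apply: (lt_trans (sP n)); apply: le_lt_trans Ne.
by rewrite mul1r lef_pV2 ?posrE ?exprn_gt0// ler_eXn2l// ltr1n.
Qed.

End BoundedBelow.

(** * A large subspace on which the operator is onto *)

Section SurjectivePart.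
Variables (R : realType) (H : hilbertType R) (T : H -> H).
Hypotheses (T_linear : linear T) (T_bounded : bounded_op T).
Hypothesis T_closed_range : closed (range T).
Variable f : H.
Hypothesis T_corange : forall x, exists a, range T (x - a *: f).

Let Rn n := range (iter n T).

Let iter_linear n : linear (iter n T).
Proof. by elim: n => [|n IH] a x y //=; rewrite IH T_linear. Qed.

Let iterB n x y : iter n T (x - y) = iter n T x - iter n T y.
Proof. exact: (zmod_morphism_linear (iter_linear n)). Qed.

Let cR1 : csubspace (range T).
Proof. by split=> //; exact: subspace_range. Qed.

Let RnS n y : Rn n.+1 y <-> exists2 x, Rn n x & T x = y.
Proof.
split=> [[x _ <-]|[_ [x _ <-] <-]]; last by exists x.
by exists (iter n T x) => //; exists x.
Qed.

Let Rn_decr n y : Rn n.+1 y -> Rn n y.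
Proof. by move=> [x _ <-]; exists (T x); rewrite // -iterSr. Qed.

Let Rn_corange n x : Rn n x -> exists a, Rn n.+1 (x - a *: iter n T f).
Proof.
move=> [z _ <-]; have [a [w _ wE]] := T_corange z; exists a, w => //.
by rewrite iterSr wE iterB (scalable_linear (iter_linear n)).
Qed.

(** Closedness passes to the next range as long as the kernel stays inside:
    then a preimage in range T^n can be prescribed by the bounded right inverse,
    since two preimages differ by an element of the kernel. *)
Let Rn_closedS n : csubspace (Rn n) -> ker T `<=` Rn n -> csubspace (Rn n.+1).
Proof.
move=> cRn KRn.
have cT : csubspace [set: H] by split; [split | exact: closedT].
have [||V [VL Vb _ TV]] :=
  @bounded_right_inverse _ _ T setT (range T) T_linear T_bounded cT cR1.
- by move=> y [x _ <-]; exists x.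
- by move=> x _; exists x.
rewrite (_ : Rn n.+1 = range T `&` V @^-1` Rn n).
  by apply: csubspaceI => //; exact: csubspace_preim.
apply/seteqP; split=> y.
- move=> /RnS[x Rx xy]; have Ty : range T y by exists x.
  split=> //; rewrite /preimage /= -(subrK x (V y)).
  apply: subspaceD => //; first exact: cRn.1.
  apply: KRn; rewrite /ker /preimage /= (zmod_morphism_linear T_linear).
  by rewrite TV// xy subrr.
- by move=> [Ty RVy]; apply/RnS; exists (V y) => //; exact: TV.
Qed.

Let Rn_closed n : (forall m, (m < n)%N -> ker T `<=` Rn m) -> csubspace (Rn n).
Proof.
elim: n => [_|n IH KR].
  rewrite (_ : Rn 0 = setT); first by split; [split | exact: closedT].
  by apply/seteqP; split=> // x _; exists x.
by apply: Rn_closedS; [apply: IH => m mn; exact/KR/ltnW | exact: KR].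
Qed.

(** If the kernel lies in every range T^n, their intersection works.
    Otherwise let N be the first index with a kernel vector k outside range T^N:
    as range T^N has codimension one in range T^(N-1), k restores what is
    missing, so T maps range T^N onto the image of range T^(N-1). *)
Lemma surjective_part : ~ finite_dim (ker T) ->
  exists M, [/\ csubspace M, forall x, M x -> M (T x),
    forall y, M y -> exists2 x, M x & T x = y & ~ finite_dim (ker T `&` M)].
Proof.
move=> Kinf; have [KR|nKR] := pselect (forall n, ker T `<=` Rn n).
- exists (\bigcap_n Rn n); split.
  + split; last by apply: closed_bigI => n _; exact: (Rn_closed (fun m _ => KR m)).2.
    split=> [n _|a x y Mx My n _]; first exact: (subspace_range (iter_linear n)).1.
    by apply: (subspace_range (iter_linear n)).2; [exact: Mx | exact: My].
  + by move=> x Mx n _; apply: Rn_decr; apply/RnS; exists x => //; exact: Mx.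
  + move=> y My; have /RnS[x _ xy] := My 1%N I; exists x => // n _.
    have /RnS[z Rz zy] := My n.+1 I; rewrite -(subrK z x).
    apply: subspaceD => //; first exact/subspace_range/iter_linear.
    by apply: (KR n); rewrite /ker /preimage /= (zmod_morphism_linear T_linear) xy zy subrr.
  + by rewrite setIidl// => x Kx n _; exact: KR.
have [N [nKN KN]] : exists N, ~ ker T `<=` Rn N /\
    forall m, (m < N)%N -> ker T `<=` Rn m.
  move/existsNP: nKR => [n]; elim/ltn_ind: n => n IH nKn.
  have [KN|] := pselect (forall m, (m < n)%N -> ker T `<=` Rn m).
    by exists n.
  by move=> /existsNP[m /not_implyP[mn /(IH _ mn)]].
case: N nKN KN => [[]|n nKN KN]; first by move=> x _; exists x.
have /existsNP[k /not_implyP[Kk nRk]] := nKN.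
have sRn : subspace (Rn n.+1) by exact/subspace_range/iter_linear.
have exch x : Rn n x -> exists c, Rn n.+1 (x - c *: k).
  move=> /Rn_corange[b Rb]; have [a Ra] := Rn_corange (KN n (ltnSn n) k Kk).
  exact: line_exchange Ra Rb nRk.
exists (Rn n.+1); split.
- exact: Rn_closed.
- by move=> x Rx; apply: Rn_decr; apply/RnS; exists x.
- move=> y /RnS[x /exch[c Rc] xy]; exists (x - c *: k) => //.
  rewrite (zmod_morphism_linear T_linear) (scalable_linear T_linear).
  by rewrite /= (Kk : T k = 0) scaler0 subr0.
- apply: contra_not Kinf; apply: (@finite_dim_add_line _ _ _ _ k) => //.
    exact: subspace_ker.
  by move=> x Kx; apply: exch; exact: KN.
Qed.

End SurjectivePart.

(** * Separability *)

Section Separability.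
Variables (R : realType) (H : hilbertType R) (v : nat -> H).
Local Notation C := R[i].

Lemma rat_complex_approx (c : C) (e : R) : 0 < e ->
  exists q : rat * rat, rnorm (c - Complex (ratr q.1) (ratr q.2)) < e.
Proof.
case: c => a b e0; have e2 : 0 < e / 2 by rewrite divr_gt0.
have approx (r : R) : exists q : rat, `|r - ratr q| < e / 2.
  have [|q] := @rat_in_itvoo R (r - e / 2) (r + e / 2); first lra.
  rewrite in_itv /= => /andP[h1 h2]; exists q.
  by rewrite ltr_norml; apply/andP; split; lra.
have [[p pa] [q qb]] := (approx a, approx b); exists (p, q) => /=.
rewrite [X in rnorm X]complexE /=; apply: (le_lt_trans (rnormD _ _)).
have i1 : rnorm ('i%C : C) = 1.
  by rewrite /rnorm normc_def /= expr0n expr1n add0r sqrtr1.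
by rewrite rnormM i1 mul1r !rnorm_real [e]splitr ltrD.
Qed.

(** Perturbing the coefficients into Q + iQ leaves countably many combinations,
    which are still dense. *)
Lemma dense_span_separable : dense (lin_span (range v)) -> separable_space H.
Proof.
move=> vd.
pose F (s : seq (nat * (rat * rat))) : H :=
  \sum_(p <- s) Complex (ratr p.2.1) (ratr p.2.2) *: v p.1.
exists (range F).
  by apply: card_le_trans (card_image_le _ _) _; exact: countableP.
pose near_range x := forall e : R, 0 < e -> exists s, rnorm (x - F s) < e.
have near_span : lin_span (range v) `<=` near_range.
  move=> _ [n [c [w [vw ->]]]]; elim/big_ind: _ => [e e0|x y Nx Ny e e0|i _ e e0].
  - by exists [::]; rewrite /F big_nil subrr rnorm0.
  - have e2 : 0 < e / 2 by rewrite divr_gt0.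
    have [[s xs] [t yt]] := (Nx _ e2, Ny _ e2); exists (s ++ t).
    rewrite /F big_cat opprD addrACA; apply: (le_lt_trans (rnormD _ _)).
    by rewrite [e]splitr ltrD.
  - have [k _ <-] := vw i.
    have k1 : 0 < rnorm (v k) + 1 by rewrite ltr_wpDl// rnorm_ge0.
    have [q qc] := rat_complex_approx (c i) (divr_gt0 e0 k1).
    exists [:: (k, q)]; rewrite /F big_seq1 -scalerBl rnormZ.
    rewrite ltr_pdivlMr// in qc; apply: le_lt_trans qc.
    by rewrite ler_wpM2l ?rnorm_ge0// lerDl.
move=> D D0 Dop; have [x [Dx /near_span xs]] := vd D D0 Dop.
have /nbhs_ballP[e /complex_gt0P[r r0 ->] eD] := open_nbhs_nbhs (conj Dop Dx).
have [s sx] := xs r r0; exists (F s); split; last by exists s.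
by apply: eD; rewrite -ball_normE /= rnormE ltcR.
Qed.

End Separability.

(** * Universality *)

(** The range of T and the line through f span a closed subspace, and it contains
    the whole orbit of f. *)
Lemma cyclic_corange (R : realType) (H : hilbertType R) (T : H -> H) (f : H) :
  linear T -> closed (range T) ->
  dense (lin_span (range (fun n => iter n T f))) ->
  forall x, exists a, range T (x - a *: f).
Proof.
move=> TL Tcl fd x; have sR := subspace_range TL.
pose L := [set x | exists a, range T (x - a *: f)].
suff LT : L = setT by have : L x by rewrite LT.
apply: (dense_sub_closed fd); first exact: closed_add_line.
apply: lin_span_min; first exact: subspace_add_line.
move=> _ [[|n] _ <-]; first by exists 1; rewrite scale1r subrr; case: sR.
by exists 0; rewrite scale0r subr0; exists (iter n T f).
Qed.

Theorem theorem22 (R : realType) (H : hilbertType R) (T : {linear H -> H})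
    (T_bounded : bounded_op T)
    (T_closed_range : closed (range T))
    (T_cyclic : cyclic_op T)
    (T_ker : ~ finite_dim (ker T)) :
  universal T.
Proof.
have TL : linear T := linearP T; have [f fd] := T_cyclic.
split.
- exact: dense_span_separable fd.
- by move=> /(finite_dim_sub (subspace_ker TL)) Kfin; apply: T_ker; exact: Kfin.
move=> A Ab.
have [M [cM TM MT Kinf]] := surjective_part TL T_bounded T_closed_range
  (cyclic_corange TL T_closed_range fd) T_ker.
have [V [VL Vb VM TV]] := bounded_right_inverse TL T_bounded cM cM MT TM.
have [e ec] := complete_system_exists fd.
have cK : csubspace (ker T `&` M) by apply: csubspaceI => //; exact: csubspace_ker.
have [u [uo u1 uK]] := infinite_dim_orthonormal cK.1 Kinf.
have [W [WL Wn WK]] := isometry_exists ec uo u1 cK uK.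
have [a [X [a0 XL Xb TX [c c0 Xc]]]] :=
  caradus TL T_bounded (linearP A) Ab VL Vb WL Wn cM VM TV (fun x => (WK x).2)
    (fun x => (WK x).1).
(* The isomorphism is the inverse of X, on the invariant subspace range X. *)
have XK : injective X.
  move=> x y xy; apply/eqP; rewrite -subr_eq0; apply/eqP/rnorm_eq0/eqP.
  rewrite eq_le rnorm_ge0 andbT; apply: (le_trans (Xc _)).
  by rewrite (zmod_morphism_linear XL) xy subrr rnorm0 mulr0.
have /choice[S SP] : forall y, exists x, range X y -> X x = y.
  move=> y; have [[x _ <-]|] := pselect (range X y); first by exists x.
  by exists 0.
have SX x : S (X x) = x by apply/XK/SP; exists x.
exists (range X), a, S, X; split=> //.
- split.
  + exact/subspaceP/subspace_range.
  + exact: closed_range_bounded_below XL Xb c0 Xc.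
  + move=> _ [x _ <-]; exists (a *: A x) => //.
    by rewrite TX (scalable_linear XL).
- split=> //.
  + by move=> b _ _ [x _ <-] [y _ <-]; rewrite -XL !SX.
  + by apply/bounded_onP; exists c => // _ [x _ <-]; rewrite SX.


- by move=> x; rewrite TX -(scalable_linear XL) SX.
Qed.
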